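(* Let $A$ be an $n\times n$ $\{0,1\}$-matrix and suppose that the following statements hold: (1) there exists $\tau\in S_n$ such that $(AP_\tau)_{ii}=1$ for all $i\in[n]$; (2) for this $\tau$ and $B=AP_\tau-I$, for each $k=1,\dots,\lfloor \frac{n}{2}\rfloor$ and each $i\in[n]$, we have $(B^{2k})_{ii}=\big((B^k)_{ii}\big)^2$. Then $0\neq\operatorname{per}(A)=\operatorname{sgn}(\tau)\det(A)$.
   Context: $[n]=\{1,\dots,n\}$. A $\{0,1\}$-matrix is a matrix all of whose entries are $0$ or $1$ (regarded as real numbers); $M_{ij}$ is the $(i,j)$-entry of $M$ and $I$ is the $n\times n$ identity matrix. $\operatorname{per}(A)=\sum_{\sigma\in S_n}\prod_{i=1}^n A_{i\sigma(i)}$ is the permanent. For $\sigma\in S_n$, $P_\sigma$ is the $n\times n$ permutation matrix with $(P_\sigma)_{ij}=1$ if $i=\sigma(j)$ and $0$ otherwise; thus $(AP_\tau)_{ij}=A_{i\,\tau(j)}$. *)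

(* Defs.v *)
From mathcomp Require Import all_boot all_order all_algebra all_fingroup.
From mathcomp Require Import reals.

Set Implicit Arguments.
Unset Strict Implicit.
Unset Printing Implicit Defensive.

Import GRing.Theory.

Local Open Scope ring_scope.

Definition zero_one_mx (R : realType) (n : nat) (A : 'M[R]_n) : Prop :=
  forall i j : 'I_n, A i j = 0 \/ A i j = 1.

Definition per (R : realType) (n : nat) (A : 'M[R]_n) : R :=
  \sum_(s : 'S_n) \prod_(i < n) A i (s i).

(* The (i, j) entry of [perm_mx s] is 1 iff j = s i, whereas that of P_s is 1
   iff i = s j; hence the inverse. *)
Definition pmx (R : realType) (n : nat) (s : 'S_n) : 'M[R]_n :=
  perm_mx (s^-1)%g.

Lemma pmxE (R : realType) (n : nat) (s : 'S_n) (i j : 'I_n) :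
  pmx R s i j = (i == s j)%:R.
Proof.
rewrite /pmx !mxE; congr (nat_of_bool _)%:R.
by apply/eqP/eqP => [<-|->]; rewrite ?permKV ?permK.
Qed.

Lemma mulmx_pmxE (R : realType) (n : nat) (A : 'M[R]_n) (s : 'S_n)
    (i j : 'I_n) :
  (A *m pmx R s) i j = A i (s j).
Proof.
rewrite mxE (bigD1 (s j)) //= big1 => [|k ksj].
  by rewrite pmxE eqxx mulr1 addr0.
by rewrite pmxE (negbTE ksj) mulr0.
Qed.

(* Main.v *)
Require Import Defs.
From mathcomp Require Import all_boot all_order all_algebra all_fingroup.
From mathcomp Require Import reals.

(** Condition (2) says that every closed walk of length [2k] from [i] in the
    digraph of [B] is back at [i] after [k] steps; a cycle of length [2k] is
    not, so the digraph has no even cycle. Hence every permutation contributing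
    to [per (A P_tau)] is a product of cycles of odd length, so it has sign [1],
    and [per (A P_tau) = \det (A P_tau)]. The identity contributes [1]. *)

Set Implicit Arguments.
Unset Strict Implicit.
Unset Printing Implicit Defensive.

Import Order.TTheory GRing.Theory Num.Theory.

Local Open Scope ring_scope.

Lemma sum_card_porbits (T : finType) (s : {perm T}) :
  (\sum_(C in porbits s) #|C| = #|T|)%N.
Proof.
have acts_s : [acts <[s]>%g, on [set: T] | 'P].
  by apply/actsP => a _ x; rewrite !inE.
rewrite -[RHS]cardsT -(acts_sum_card_orbit acts_s).
apply: eq_bigl => C.
by apply/imsetP/imsetP => -[x _ ->]; exists x; rewrite ?inE ?porbitE.
Qed.

(** The parity of [s] is that of [#|T|] plus the number of orbits. Odd orbit sizes add up to [#|T|],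
    which then has the parity of the number of orbits. *)
Lemma odd_perm_odd_porbits (T : finType) (s : {perm T}) :
  (forall x, odd #|porbit s x|) -> s = false :> bool.
Proof.
move=> odd_s; rewrite /odd_perm -(sum_card_porbits s) -sum1_card.
elim/big_rec2: _ => // C m p /imsetP[x _ ->] IH.
by rewrite !oddD odd_s /= addbN addNb negbK.
Qed.

Section NonnegativeMatrix.
Variables (R : numDomainType) (n : nat) (B : 'M[R]_n).
Hypothesis B_ge0 : forall i j, 0 <= B i j.

Lemma expmx_ge0 k i j : 0 <= (B ^+ k) i j.
Proof.
elim: k i j => [|k IH] i j; first by rewrite expr0 mxE ler0n.
by rewrite exprS mxE sumr_ge0 // => l _; rewrite mulr_ge0.
Qed.

(** The walk along [s] contributes a positive product, and all other walks contribute nonnegative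
    ones. *)
Lemma expmx_perm_gt0 (s : 'S_n) k i :
  (forall m, 0 < B ((s ^+ m)%g i) (s ((s ^+ m)%g i))) ->
  0 < (B ^+ k) i ((s ^+ k)%g i).
Proof.
move=> Bs; elim: k => [|k IH].
  by rewrite expr0 expg0 perm1 mxE eqxx ltr01.
rewrite exprSr mxE (bigD1 ((s ^+ k)%g i)) //= ltr_wpDr //.
  by rewrite sumr_ge0 // => l _; rewrite mulr_ge0 // expmx_ge0.
by rewrite expgSr permM mulr_gt0.
Qed.

(** Positivity is asked only off the fixed points of [s], since the intended [B] has zero diagonal;
    a fixed point is an orbit of odd size 1. *)
Lemma porbit_odd_of_square_diag (s : 'S_n) i :
  (forall k, (1 <= k <= n./2)%N ->
     (B ^+ (2 * k)) i i = ((B ^+ k) i i) ^+ 2) ->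
  (forall x, s x != x -> 0 < B x (s x)) ->
  odd #|porbit s i|.
Proof.
move=> B2 Bs; apply/negPn/negP => even_m.
set m := #|porbit s i| in even_m; set k := m./2.
have mE : m = (k + k)%N by rewrite addnn /k even_halfK.
have m_gt0 : (0 < m)%N by apply/card_gt0P; exists i; apply: porbit_id.
have k_gt0 : (0 < k)%N by move: m_gt0; rewrite mE addn_gt0 orbb.
have k_le : (k <= n./2)%N.
  by apply: half_leq; rewrite -[leqRHS]card_ord max_card.
have sm : (s ^+ m)%g i = i by rewrite permX iter_porbit.
have sk : (s ^+ k)%g i != i.
  have := uniq_traject_porbit s i; rewrite -/m mE.
  case: (k) k_gt0 => // k' _ /=; case/andP=> /trajectP ni _.
  apply/eqP => ski; case: ni; exists k'; first by rewrite addnS ltnS leq_addl.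
  by rewrite -iterSr -permX.
(* A fixed point on the orbit would force [s i = i], hence [s ^+ k] would fix [i]. *)
have moves j : s ((s ^+ j)%g i) != (s ^+ j)%g i.
  apply/eqP; rewrite -permM -expgSr expgS permM => /perm_inj si.
  by case/eqP: sk; rewrite permX; elim: (k) => //= k' ->.
have Bi : 0 < (B ^+ k) i ((s ^+ k)%g i).
  by apply: expmx_perm_gt0 => j; apply: Bs.
have Bk : 0 < (B ^+ k) ((s ^+ k)%g i) i.
  rewrite -{2}sm mE expgnDr permM; apply: expmx_perm_gt0 => j; apply: Bs.
  by rewrite -(permM (s ^+ k)%g) -expgnDr moves.
have := B2 k; rewrite k_gt0 k_le => /(_ isT) /eqP.
(* In the sum for the diagonal entry of [B ^+ k * B ^+ k], the index [i] already gives the square,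
   and the index [(s ^+ k) i] adds a positive excess. *)
rewrite mul2n -addnn exprD mxE (bigD1 i) //= (bigD1 ((s ^+ k)%g i)) //=.
rewrite expr2 -subr_eq0 addrAC subrr add0r gt_eqF //.
rewrite ltr_wpDr ?mulr_gt0 // sumr_ge0 // => l _.
by rewrite mulr_ge0 // expmx_ge0.
Qed.

End NonnegativeMatrix.

Lemma per_mul_pmx (R : realType) (n : nat) (A : 'M[R]_n) (t : 'S_n) :
  per (A *m pmx R t) = per A.
Proof.
rewrite [RHS](reindex_inj (mulIg t)); apply: eq_bigr => s _.
by apply: eq_bigr => i _; rewrite mulmx_pmxE permM.
Qed.

Lemma det_mul_pmx (R : realType) (n : nat) (A : 'M[R]_n) (t : 'S_n) :
  \det (A *m pmx R t) = (-1) ^+ t * \det A.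
Proof. by rewrite det_mulmx det_perm odd_permV mulrC. Qed.

Theorem theorem3p5 (R : realType) (n : nat) (A : 'M[R]_n) (tau : 'S_n) (B : 'M[R]_n)
  (hA : zero_one_mx A)
  (h1 : forall i : 'I_n, (A *m pmx R tau) i i = 1)
  (hB : B = A *m pmx R tau - 1%:M)
  (h2 : forall k : nat, (1 <= k <= n./2)%N ->
          forall i : 'I_n, (B ^+ (2 * k)) i i = ((B ^+ k) i i) ^+ 2) :
  0 != per A /\ per A = (-1) ^+ tau * \det A.
Proof.
rewrite -det_mul_pmx -(per_mul_pmx A tau).
set C := A *m pmx R tau in h1 hB *.
have C01 i j : C i j = 0 \/ C i j = 1 by rewrite mulmx_pmxE.
have C_ge0 i j : 0 <= C i j by case: (C01 i j) => ->; rewrite ?ler01.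
have BE i j : B i j = if i == j then 0 else C i j.
  (* Generalizing [C] keeps [mxE] from expanding the matrix product. *)
  by rewrite hB; move: (C) h1 => D h1; rewrite !mxE; case: eqP => [->|_];
    rewrite ?h1 ?subrr ?subr0.
have B_ge0 i j : 0 <= B i j by rewrite BE; case: ifP.
split.
  rewrite eq_sym gt_eqF // /per (bigD1 1%g) //= ltr_wpDr //.
    by apply: sumr_ge0 => s _; apply: prodr_ge0.
  by rewrite big1 ?ltr01 // => i _; rewrite perm1.
apply: eq_bigr => s _.
(* The expansions agree term by term: either [s] runs along nonzero entries and is even, or both
   terms vanish. *)
have [/forallP Cs|/forallPn[i]] := boolP [forall i, C i (s i) != 0].
  rewrite odd_perm_odd_porbits ?mul1r // => i.
  apply: (porbit_odd_of_square_diag B_ge0) => [k hk|x sx]; first exact: h2.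
  by rewrite BE eq_sym (negbTE sx) lt_neqAle eq_sym Cs C_ge0.
by rewrite negbK => /eqP Ci; rewrite (bigD1 i) //= Ci mul0r mulr0.
Qed.
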